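(* The generalized quadratic B-splines $\{B_k,\ 0\le k\le 2n+1\}$ form a basis of the vector space $GS_2(\beta)$. Moreover, they form a partition of unity (a blending system) in this space, i.e. they are nonnegative on $I$ and $\sum_{k=0}^{2n+1}B_k=1$ on $I$.
   Context: Setting. Let $n\ge 1$, $I=[a,b]$, $X=\{a=x_0<x_1<\dots<x_n=b\}$ a partition of $I$, $I_i=[x_{i-1},x_i]$, $h_i=x_i-x_{i-1}$, $m_i=\frac12(x_{i-1}+x_i)$ for $1\le i\le n$. Let $\beta=(\beta_1,\dots,\beta_n)$ with $\beta_i\in[-1,0[$ and $\theta_i=\frac12\frac{\beta_i}{\beta_i-1}\in\,]0,\frac14]$ (equivalently $\beta_i=\frac{-2\theta_i}{1-2\theta_i}$). The space $V(\beta_i)$ (generated by the Merrien subdivision algorithm) is the set of $C^1$ functions $f$ on $I_i$ such that for every dyadic subinterval $[u,v]$ of $I_i$ (i.e. every interval obtained from $I_i$ by repeated bisection, including $I_i$ itself), with $m=\frac12(u+v)$ and $h=v-u$, $$f(m)=\tfrac12\big(f(u)+f(v)-\theta_i h\,(f'(v)-f'(u))\big),\qquad f'(m)=\frac{1}{1-2\theta_i}\Big(\frac{f(v)-f(u)}{h}-2\theta_i\,\frac{f'(u)+f'(v)}{2}\Big).$$ It is known that for any prescribed values of $f,f'$ at the two endpoints of $I_i$ there is exactly one such $f$; so $\dim V(\beta_i)=4$. $GS_2(\beta)=GS_2(I,X,\beta)$ is the space of all $g\in C^1(I)$ with $g|_{I_i}\in V(\beta_i)$ for all $1\le i\le n$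 (generalized quadratic splines); it has dimension $2n+2$. The list of B-coefficients of $f\in V(\beta_i)$ on $I_i$ is $[\,f(x_{i-1}),\ f(x_{i-1})+\theta_ih_if'(x_{i-1}),\ f(x_i)-\theta_ih_if'(x_i),\ f(x_i)\,]$; it determines $f$ uniquely. For $1\le i\le n-1$ let $\omega_i=\frac{\theta_{i+1}h_{i+1}}{\theta_ih_i+\theta_{i+1}h_{i+1}}$. The generalized quadratic B-splines are the functions on $I$ defined by their B-coefficients as follows (all B-coefficients on subintervals not mentioned are zero). For $1\le i\le n-1$: $B_{2i}$ has lists $[0,0,1,\omega_i]$ on $I_i$ and $[\omega_i,0,0,0]$ on $I_{i+1}$; $B_{2i+1}$ has lists $[0,0,0,1-\omega_i]$ on $I_i$ and $[1-\omega_i,1,0,0]$ on $I_{i+1}$. At the ends: $B_0$ has list $[1,0,0,0]$ on $I_1$; $B_1$ has list $[0,1,0,0]$ on $I_1$; $B_{2n}$ has list $[0,0,1,0]$ on $I_n$; $B_{2n+1}$ has list $[0,0,0,1]$ on $I_n$. *)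

(* Defs.v *)
From HB Require Import structures.
From mathcomp Require Import all_boot all_order all_algebra.
From mathcomp Require Import all_classical all_reals all_analysis.
Import Order.TTheory GRing.Theory Num.Theory.
Import numFieldNormedType.Exports.
Set Implicit Arguments.
Unset Strict Implicit.
Unset Printing Implicit Defensive.
Local Open Scope classical_set_scope.
Local Open Scope ring_scope.

(* The "iff" entails that [W] is a linear subspace and that each [e k] lies
   in [W]. *)
Definition is_basis (R : realType) (E : lmodType R) (W : set E) (m : nat)
    (e : 'I_m -> E) : Prop :=
  (forall c : 'I_m -> R, \sum_(k < m) c k *: e k = 0 -> forall k, c k = 0) /\
  (forall g : E, W g <-> exists c : 'I_m -> R, g = \sum_(k < m) c k *: e k).

Section C1.
Variable R : realType.
Implicit Types (f : R -> R) (A : set R).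

(* [x^'] is the punctured neighborhood filter of x: the derivative below only
   looks at [f] on [A], so it is one-sided at the endpoints of an interval. *)
Definition slope f (x y : R) : R := (f y - f x) / (y - x).

Definition derivable_on A f (x : R) : Prop :=
  cvg (slope f x y @[y --> within A x^']).

Definition derive_on A f (x : R) : R :=
  lim (slope f x y @[y --> within A x^']).

Definition C1_on A f : Prop :=
  (forall x, A x -> derivable_on A f x) /\ {within A, continuous (derive_on A f)}.

End C1.

Section MerrienSpace.
Variable R : realType.
Implicit Types (f : R -> R) (beta : R).

Definition mid (u v : R) : R := (u + v) / 2.

Inductive dyadic_sub (p q : R) : R -> R -> Prop :=
| dyadic_self : dyadic_sub p q p q
| dyadic_left u v : dyadic_sub p q u v -> dyadic_sub p q u (mid u v)
| dyadic_right u v : dyadic_sub p q u v -> dyadic_sub p q (mid u v) v.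

Definition theta_of beta : R := 1 / 2 * (beta / (beta - 1)).

Definition merrien_space beta (p q : R) f : Prop :=
  let theta := theta_of beta in
  let f' := derive_on `[p, q] f in
  C1_on `[p, q] f /\
  forall u v, dyadic_sub p q u v ->
    let h := v - u in
    f (mid u v) = 1 / 2 * (f u + f v - theta * h * (f' v - f' u)) /\
    f' (mid u v) = 1 / (1 - 2 * theta) *
      ((f v - f u) / h - 2 * theta * ((f' u + f' v) / 2)).

Definition bcoefs beta (p q : R) f : seq R :=
  let theta := theta_of beta in
  let h := q - p in
  let f' := derive_on `[p, q] f in
  [:: f p; f p + theta * h * f' p; f q - theta * h * f' q; f q].

End MerrienSpace.

Section Splines.
Variable R : realType.
(* Knots are x 0, ..., x n and the i-th subinterval is [x i.-1, x i], with
   parameter beta i, for 1 <= i <= n; other values of x and beta are unused. *)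
Implicit Types (x beta : nat -> R) (n i k : nat).

Definition is_partition (a b : R) n x : Prop :=
  x 0%N = a /\ x n = b /\ forall i, (1 <= i <= n)%N -> x i.-1 < x i.

(* A function on [a, b] is represented by its extension by zero to R, so that
   functions on [a, b] form a subspace of R -> R and equality of functions on
   [a, b] is Leibniz equality. *)
Definition fun_on (a b : R) (g : R -> R) : Prop :=
  forall t, t \notin `[a, b] -> g t = 0.

Definition GS2 (a b : R) n x beta : set (R -> R) :=
  [set g | fun_on a b g /\ C1_on `[a, b] g /\
    forall i, (1 <= i <= n)%N -> merrien_space (beta i) (x i.-1) (x i) g].

Definition omega x beta i : R :=
  let th j := theta_of (beta j) * (x j - x j.-1) in
  th i.+1 / (th i + th i.+1).

(* List of B-coefficients of the k-th B-spline on the i-th subinterval,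
   0 <= k <= 2 n + 1. *)
Definition bspline_bcoefs n x beta k i : seq R :=
  let zero := [:: 0; 0; 0; 0] in
  if k == 0%N then if i == 1%N then [:: 1; 0; 0; 0] else zero
  else if k == 1%N then if i == 1%N then [:: 0; 1; 0; 0] else zero
  else if k == (2 * n)%N then if i == n then [:: 0; 0; 1; 0] else zero
  else if k == (2 * n + 1)%N then if i == n then [:: 0; 0; 0; 1] else zero
  else
    let j := k./2 in
    let w := omega x beta j in
    if odd k then
      if i == j then [:: 0; 0; 0; 1 - w]
      else if i == j.+1 then [:: 1 - w; 1; 0; 0] else zero
    else
      if i == j then [:: 0; 0; 1; w]
      else if i == j.+1 then [:: w; 0; 0; 0] else zero.

Definition is_bspline (a b : R) n x beta k (g : R -> R) : Prop :=
  fun_on a b g /\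
  forall i, (1 <= i <= n)%N ->
    merrien_space (beta i) (x i.-1) (x i) g /\
    bcoefs (beta i) (x i.-1) (x i) g = bspline_bcoefs n x beta k i.

(* The function with these B-coefficients exists and is unique; the default
   value 0 of [xget] is never used for 0 <= k <= 2 n + 1. *)
Definition bspline (a b : R) n x beta k : R -> R :=
  xget (0 : R -> R) [set g | is_bspline a b n x beta k g].

End Splines.

(* Main.v *)
Require Import Defs.
From mathcomp Require Import all_boot all_order all_algebra.
From mathcomp Require Import all_classical all_reals all_analysis.
From mathcomp Require Import ring lra zify.
Import Order.TTheory GRing.Theory Num.Theory.
Import numFieldNormedType.Exports.
Set Implicit Arguments.
Unset Strict Implicit.
Unset Printing Implicit Defensive.
Local Open Scope classical_set_scope.
Local Open Scope ring_scope.

(** Everything is read off the B-coefficients, which turn the recursion that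
    defines V(beta) into corner cutting. If f has B-coefficients
    [c0, c1, c2, c3] on [u, v], then those on the left half are
    [c0, (c0 + c1) / 2, (1 + r) / 2 c1 + (1 - r) / 2 c2, (c1 + c2) / 2], with
    r = theta / (1 - 2 theta) in ]0, 1/2], and symmetrically on the right half.
    These are convex combinations, so nonnegative coefficients stay nonnegative
    on all dyadic subintervals ([merrien_corner_cutting]), and f >= 0 by density
    and continuity ([merrien_ge0]). Applied to f - g and g - f, this also shows
    that the four coefficients determine f ([merrien_unique]).

    That all coefficients are attained ([merrien_exists]) requires a limit. On
    derivatives, bisection replaces the values (A, M, B) at u, mid u v, v by
    (A, rho A + (1 - rho) M, M) and (M, (1 - rho) M + rho B, B), where
    rho = - beta / 2 is the number r above. Hence f' runs from A to M, and from
    M to B, along affine copies of one continuous function S of de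
    Rham type, equal to 0 before 0 and to 1 after 1 and satisfying
    S s = (1 - rho) S (2 s) + rho (1 - S (2 - 2 s)) ([derhamE]). It is obtained
    as the fixed point of a contraction. With F the primitive of S, V(beta) on
    [u, v] is spanned by 1, t, F (2 (t - u) / (v - u)) and
    F (2 (v - t) / (v - u)): the functional equation of F ([derham_intE]) makes
    this span the same on both halves as on the whole interval, so the Merrien
    relations need only be checked for one interval at a time
    ([derham_form_merrien]).

    For splines, a function that lies piecewise in V(beta i) has coefficients
    [G_(i-1), p_i, q_i, G_i] on the i-th subinterval, and its one-sided
    derivatives agree at an interior knot exactly when
    G_i = omega_i q_i + (1 - omega_i) p_(i+1) ([derive_match]). So
    d = (G_0, p_1, q_1, ..., p_n, q_n, G_n) is a free system of 2 n + 2
    coordinates on GS_2 ([has_spline_bcoefs_exists], [has_spline_bcoefs_unique],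
    [has_spline_bcoefs_GS2], [GS2_has_spline_bcoefs]). The B-spline B_k is the
    element with coordinates d_j = (j == k) ([bsplineP]), which makes the B_k a
    basis. They are nonnegative since their coefficients are, and their sum has
    all coefficients 1, like the constant function 1. *)

(** * Derivatives relative to a subset of the line *)

Section RelativeDerivative.
Variable R : realType.
Implicit Types (f g : R -> R) (A B : set R) (p q x : R).

(** The relation form of [derive_on]: unlike the limit operator, it can be
    combined and restricted before its value is known to be unique. *)
Definition has_derive_on A f x (l : R) := slope f x y @[y --> within A x^'] --> l.

(** Uniqueness of the one-sided derivative at an endpoint needs the interval to
    accumulate there, which is where p < q enters. *)
Lemma within_punctured_proper p q x :
  p < q -> x \in `[p, q] -> ProperFilter (within `[p, q] x^').
Proof.
move=> pq; rewrite in_itv/= => /andP[px xq].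
apply: Build_ProperFilter_ex => P.
rewrite /within /dnbhs /within /= => -/nbhs_ballP[e/= e0 He].
have [xltq|qlex] := ltP x q.
  pose y := x + Num.min (e / 2) (q - x).
  have m1 : Num.min (e / 2) (q - x) <= e / 2 by rewrite ge_min lexx.
  have m2 : Num.min (e / 2) (q - x) <= q - x by rewrite ge_min lexx orbT.
  have m0 : 0 < Num.min (e / 2) (q - x) by rewrite lt_min; lra.
  exists y; apply: He; rewrite /y.
  - by rewrite /ball/= opprD addNKr normrN gtr0_norm //; lra.
  - by rewrite -subr_eq0 addrAC subrr add0r gt_eqF.
  - by rewrite in_itv/=; lra.
have xE : x = q by apply/eqP; rewrite eq_le xq.
subst x.
pose y := q - Num.min (e / 2) (q - p).
have m1 : Num.min (e / 2) (q - p) <= e / 2 by rewrite ge_min lexx.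
have m2 : Num.min (e / 2) (q - p) <= q - p by rewrite ge_min lexx orbT.
have m0 : 0 < Num.min (e / 2) (q - p) by rewrite lt_min; lra.
exists y; apply: He; rewrite /y.
- by rewrite /ball/= opprB addrC subrK gtr0_norm //; lra.
- by rewrite -subr_eq0 addrAC subrr add0r oppr_eq0 gt_eqF.
- by rewrite in_itv/=; lra.
Qed.

Lemma nbhs_within_punctured A x : within A x^' `=>` nbhs x.
Proof.
move=> P xP; suff : x^' (fun y => A y -> P y) by [].
by apply: filterS xP => y Py _ _.
Qed.

Lemma has_derive_onE p q f x l : p < q -> x \in `[p, q] ->
  has_derive_on `[p, q] f x l -> derive_on `[p, q] f x = l.
Proof.
move=> pq xpq fl; have ? := within_punctured_proper pq xpq.
exact: (cvg_lim (@Rhausdorff R) fl).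
Qed.

Lemma has_derive_onS A B f x l :
  A `<=` B -> has_derive_on B f x l -> has_derive_on A f x l.
Proof.
by move=> AB; apply: cvg_trans; apply: cvg_fmap2; exact: within_subset.
Qed.

Lemma has_derive_onU A B f x l : has_derive_on A f x l ->
  has_derive_on B f x l -> has_derive_on (A `|` B) f x l.
Proof.
move=> fA fB P lP.
have PA : x^' (fun y => A y -> P (slope f x y)) := fA P lP.
have PB : x^' (fun y => B y -> P (slope f x y)) := fB P lP.
suff : x^' (fun y => (A `|` B) y -> P (slope f x y)) by [].
by apply: filterS2 PA PB => y yA yB [/yA|/yB].
Qed.

(** Vacuous case of gluing: away from A, the piece on A puts no constraint on
    the derivative. *)
Lemma has_derive_on_out A f x l :
  (\forall y \near x, ~ A y) -> has_derive_on A f x l.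
Proof.
move=> xA P lP.
suff : x^' (fun y => A y -> P (slope f x y)) by [].
by apply: filterS xA => y nAy _ /nAy.
Qed.

Lemma has_derive_on_eq A f g x l : (forall y, A y -> f y = g y) -> A x ->
  has_derive_on A f x l -> has_derive_on A g x l.
Proof.
move=> fg Ax; apply: cvg_trans; apply: near_eq_cvg.
by rewrite near_withinE; near=> y => Ay; rewrite /slope !fg.
Unshelve. all: by end_near. Qed.

Lemma has_derive_on_lin A f g x l k (c : R) :
  has_derive_on A f x l -> has_derive_on A g x k ->
  has_derive_on A (c *: f + g) x (c * l + k).
Proof.
move=> fl gk; rewrite /has_derive_on.
rewrite (_ : slope _ x = (fun y => c * slope f x y + slope g x y)); last first.
  by apply/funext => y; rewrite /slope !fctE /GRing.scale/=; ring.
by apply: cvgD gk; apply: cvgMr.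
Qed.

Lemma is_derive_has_derive_on A f x l :
  is_derive x 1 f l -> has_derive_on A f x l.
Proof.
move=> /is_derive1_caratheodory[g [fg gx <-]].
have : g y @[y --> within A x^'] --> g x.
  apply: cvg_trans gx; apply: cvg_fmap2; exact: nbhs_within_punctured.
apply: cvg_trans; apply: near_eq_cvg.
rewrite near_withinE /dnbhs near_withinE.
by near=> y => yx _; rewrite /slope fg mulfK // subr_eq0.
Unshelve. all: by end_near. Qed.

Lemma has_derive_on_continuous A f x l : A x -> has_derive_on A f x l ->
  f y @[y --> within A (nbhs x)] --> f x.
Proof.
move=> Ax fl.
have H : (slope f x y * (y - x) + f x) @[y --> within A x^'] --> f x.
  rewrite -[X in _ --> X]add0r -(mulr0 l) -(subrr x).
  apply: cvgD; last exact: cvg_cst.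
  apply: cvgM => //; apply: cvgB; last exact: cvg_cst.
  exact: nbhs_within_punctured.
move=> P Px.
have : nbhs x (fun y => y != x -> A y -> P (slope f x y * (y - x) + f x)).
  exact: H P Px.
suff : nbhs x (fun y => y != x -> A y -> P (slope f x y * (y - x) + f x)) ->
  nbhs x (fun y => A y -> P (f y)) by [].
apply: filterS => y yP Ay.
have [->|yx] := eqVneq y x; first exact: nbhs_singleton.
by have := yP yx Ay; rewrite /slope divfK ?subrK // subr_eq0.
Qed.

Lemma C1_onI p q f g : p < q ->
  (forall x, x \in `[p, q] -> has_derive_on `[p, q] f x (g x)) ->
  {within `[p, q], continuous g} -> C1_on `[p, q] f.
Proof.
move=> pq fg cg; split.
  by move=> x xpq; apply/cvg_ex; exists (g x); exact: fg.
apply: subspace_eq_continuous cg => x /set_mem xpq.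
exact: esym (has_derive_onE pq xpq (fg x xpq)).
Qed.

Lemma C1_on_derive p q f x : C1_on `[p, q] f -> x \in `[p, q] ->
  has_derive_on `[p, q] f x (derive_on `[p, q] f x).
Proof. by move=> [df _]; exact: df. Qed.

Lemma C1_on_continuous p q f : C1_on `[p, q] f -> {within `[p, q], continuous f}.
Proof.
move=> fC1; apply/subspace_continuousP => x xpq.
exact: has_derive_on_continuous xpq (C1_on_derive fC1 xpq).
Qed.

Lemma C1_on_lin p q f g (c : R) : p < q ->
  C1_on `[p, q] f -> C1_on `[p, q] g -> C1_on `[p, q] (c *: f + g).
Proof.
move=> pq fC gC.
apply: (@C1_onI _ _ _ (c *: derive_on `[p, q] f + derive_on `[p, q] g)) => //.
  by move=> x xpq; apply: has_derive_on_lin; exact: C1_on_derive.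
apply/subspace_continuousP => x xpq; apply: cvgD.
  by apply: cvgMr; have /subspace_continuousP := fC.2; exact.
by have /subspace_continuousP := gC.2; exact.
Qed.

Lemma derive_on_lin p q f g (c x : R) : p < q -> x \in `[p, q] ->
  C1_on `[p, q] f -> C1_on `[p, q] g ->
  derive_on `[p, q] (c *: f + g) x =
  c * derive_on `[p, q] f x + derive_on `[p, q] g x.
Proof.
by move=> pq xpq fC gC; apply: has_derive_onE => //; apply: has_derive_on_lin;
  exact: C1_on_derive.
Qed.

Lemma derive_on_sub p q r s f x : r < s -> `[r, s] `<=` `[p, q] ->
  C1_on `[p, q] f -> x \in `[r, s] ->
  derive_on `[r, s] f x = derive_on `[p, q] f x.
Proof.
move=> rs sub fC xrs; apply: has_derive_onE => //.
by apply: (has_derive_onS sub); apply: C1_on_derive => //; exact: sub.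
Qed.

Lemma C1_on_eq p q f g : p < q -> (forall x, x \in `[p, q] -> f x = g x) ->
  C1_on `[p, q] f -> C1_on `[p, q] g.
Proof.
move=> pq fg fC; apply: (C1_onI pq _ fC.2) => x xpq.
by apply: (has_derive_on_eq _ xpq (C1_on_derive fC xpq)).
Qed.

(** At q the difference quotients split into those taken on either side; at any
    other point only one of the two intervals accumulates. *)
Lemma C1_on_glue p q r f : p < q -> q < r ->
  C1_on `[p, q] f -> C1_on `[q, r] f ->
  derive_on `[p, q] f q = derive_on `[q, r] f q ->
  C1_on `[p, r] f.
Proof.
move=> pq qr fL fR dq.
have pr := lt_trans pq qr.
have UE : [set` `[p, r]] = [set` `[p, q]] `|` [set` `[q, r]].
  apply/seteqP; split => t /=; rewrite !in_itv/=.
    by case: (leP t q); [left|right]; lra.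
  by case; lra.
pose g t := if t <= q then derive_on `[p, q] f t else derive_on `[q, r] f t.
have gL t : t \in `[p, q] -> derive_on `[p, q] f t = g t.
  by rewrite in_itv/= /g => /andP[_ ->].
have gR t : t \in `[q, r] -> derive_on `[q, r] f t = g t.
  rewrite in_itv/= /g => /andP[qt _]; case: (leP t q) => // tq.
  by have -> : t = q by apply/eqP; rewrite eq_le tq.
apply: (@C1_onI p r f g) => //.
  move=> t; rewrite in_itv/= => /andP[pt tr]; rewrite UE.
  have [tq|qt|tE] := ltgtP t q.
  - apply: has_derive_onU.
      have tpq : t \in `[p, q] by rewrite in_itv/=; lra.
      by rewrite -gL //; exact: C1_on_derive.
    apply: has_derive_on_out; near=> y; rewrite /= in_itv/=.
    by apply/negP; rewrite negb_and -ltNge; apply/orP; left; near: y; exact: lt_nbhsl.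
  - apply: has_derive_onU; last first.
      have tqr : t \in `[q, r] by rewrite in_itv/=; lra.
      by rewrite -gR //; exact: C1_on_derive.
    apply: has_derive_on_out; near=> y; rewrite /= in_itv/=.
    by apply/negP; rewrite negb_and -!ltNge; apply/orP; right; near: y; exact: lt_nbhsr.
  - subst t; apply: has_derive_onU.
      have tpq : q \in `[p, q] by rewrite in_itv/=; lra.
      by rewrite -gL //; exact: C1_on_derive.
    have tqr : q \in `[q, r] by rewrite in_itv/=; lra.
    by rewrite -gR //; exact: C1_on_derive.
rewrite UE; apply: withinU_continuous.
- exact: interval_closed.
- exact: interval_closed.
- by apply: subspace_eq_continuous fL.2 => t /set_mem; exact: gL.
- by apply: subspace_eq_continuous fR.2 => t /set_mem; exact: gR.
Unshelve. all: by end_near. Qed.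

End RelativeDerivative.

(** * The de Rham function and its primitive *)

Section DeRham.
Variables (R : realType) (rho : R).
Hypotheses (rho0 : 0 < rho) (rho1 : rho < 1).
Implicit Types (g : R -> R) (s : R).

(** The boundary behaviour that makes [derham_step] a contraction, see
    [step_contraction]. *)
Definition ramp g :=
  (forall s, s <= 0 -> g s = 0) /\ (forall s, 1 <= s -> g s = 1).

(** Self-similarity of the derivative of a Merrien function, normalized to run
    from 0 to 1: the left half is a copy scaled by 1 - rho, the right half a
    reversed copy scaled by rho. Since functions equal 0 before 0 and 1 after 1,
    both halves are covered by one formula without case distinction. *)
Definition derham_step g s := (1 - rho) * g (2 * s) + rho * (1 - g (2 - 2 * s)).

Definition derham_iter n := iter n derham_step (fun s => Num.max 0 (Num.min s 1)).

Definition derham s : R := lim (derham_iter n s @[n --> \oo]).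

Let rho1' : 0 <= 1 - rho. Proof. by rewrite subr_ge0 ltW. Qed.

Lemma ramp_step g : ramp g -> ramp (derham_step g).
Proof.
move=> [g0 g1]; split => s s0; rewrite /derham_step.
  by rewrite (g0 (2 * s)) ?(g1 (2 - 2 * s)); lra.
by rewrite (g1 (2 * s)) ?(g0 (2 - 2 * s)); lra.
Qed.

Lemma ramp_iter n : ramp (derham_iter n).
Proof.
elim: n => [|n IH]; last exact: ramp_step.
split => s s0; rewrite /derham_iter/=.
  by rewrite min_l ?max_l //; exact: le_trans s0 ler01.
by rewrite min_r // max_r.
Qed.

Lemma iter_bound n s : 0 <= derham_iter n s <= 1.
Proof.
elim: n s => [|n IH] s.
  by rewrite /derham_iter/= le_max lexx/= ge_max ler01 ge_min lexx orbT.
have := IH (2 * s); have := IH (2 - 2 * s).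
rewrite -[derham_iter n.+1 s]/(derham_step (derham_iter n) s) /derham_step.
set X := derham_iter n _; set Y := derham_iter n _ => /andP[X0 X1] /andP[Y0 Y1].
have := mulr_ge0 rho1' X0; have := mulr_ge0 (ltW rho0) Y0.
have X1' : 0 <= 1 - X by lra.
have Y1' : 0 <= 1 - Y by lra.
have := mulr_ge0 rho1' X1'; have := mulr_ge0 (ltW rho0) Y1'.
have := mulr_ge0 rho1' Y1'; have := mulr_ge0 (ltW rho0) X1'.
have := mulr_ge0 rho1' Y0; have := mulr_ge0 (ltW rho0) X0.
by move=> *; apply/andP; split; lra.
Qed.

Let r := Num.max rho (1 - rho).

Let r0 : 0 < r. Proof. by rewrite /r lt_max rho0. Qed.
Let r1 : r < 1. Proof. by rewrite /r gt_max rho1/= gtrBl. Qed.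

(** On each side of 1 / 2 one of the two terms is the same constant for all
    ramps, so distances shrink by rho or 1 - rho, not by their sum 1. *)
Lemma step_contraction g k C : ramp g -> ramp k ->
  (forall s, `|g s - k s| <= C) ->
  forall s, `|derham_step g s - derham_step k s| <= r * C.
Proof.
move=> [g0 g1] [k0 k1] gk s.
have C0 : 0 <= C by exact: le_trans (normr_ge0 _) (gk 0).
have rr : rho <= r by rewrite /r le_max lexx.
have rr' : 1 - rho <= r by rewrite /r le_max lexx orbT.
rewrite /derham_step; have [sh|sh] := leP s (1 / 2).
  rewrite (g1 (2 - 2 * s)) ?(k1 (2 - 2 * s)); [|lra..].
  have := gk (2 * s); set X := g _; set Y := k _ => XY.
  rewrite (_ : _ - _ = (1 - rho) * (X - Y)); last ring.
  rewrite normrM ger0_norm //.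
  by apply: ler_pM.
rewrite (g1 (2 * s)) ?(k1 (2 * s)); [|lra..].
have := gk (2 - 2 * s); set X := g _; set Y := k _ => XY.
rewrite (_ : _ - _ = - (rho * (X - Y))); last ring.
rewrite normrN normrM gtr0_norm //.
by apply: ler_pM => //; exact: ltW.
Qed.

Lemma iter_dist n s : `|derham_iter n.+1 s - derham_iter n s| <= r ^+ n.
Proof.
elim: n s => [|n IH] s.
  have /andP[a b] := iter_bound 1 s; have /andP[c d] := iter_bound 0 s.
  by rewrite expr0 ler_norml; apply/andP; split; lra.
rewrite exprS; apply: (step_contraction (ramp_iter n.+1) (ramp_iter n)).
exact: IH.
Qed.

Let C := 1 / (1 - r).
Let CE : C = 1 + r * C. Proof. by rewrite /C; field; rewrite subr_eq0 gt_eqF. Qed.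
Let C0 : 0 < C. Proof. by rewrite /C divr_gt0 // subr_gt0. Qed.

(** The enclosures f_n - C r^n <= S <= f_n + C r^n are nested because
    |f_(n+1) - f_n| <= r^n = C r^n - C r^(n+1); this gives convergence and its
    rate at once. *)
Let lower_nd s :
  {homo (fun n => derham_iter n s - C * r ^+ n) : m n / (m <= n)%N >-> m <= n}.
Proof.
apply/nondecreasing_seqP => n.
have := iter_dist n s; rewrite ler_norml => /andP[+ _].
by rewrite exprS {1}CE; set e := r ^+ n => H; lra.
Qed.

Let upper_ni s :
  {homo (fun n => derham_iter n s + C * r ^+ n) : m n / (m <= n)%N >-> n <= m}.
Proof.
apply/nonincreasing_seqP => n.
have := iter_dist n s; rewrite ler_norml => /andP[_].
by rewrite exprS {2}CE; set e := r ^+ n => H; lra.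
Qed.

Let Crn : C * r ^+ n @[n --> \oo] --> (0 : R).
Proof.
rewrite -(mulr0 C); apply: cvgMr; apply: cvg_expr.
by rewrite gtr0_norm.
Qed.

Lemma derham_cvg s : derham_iter n s @[n --> \oo] --> derham s.
Proof.
suff : cvgn (fun n => derham_iter n s) by [].
have : cvgn (fun n => derham_iter n s - C * r ^+ n).
  apply: nondecreasing_is_cvgn; first exact: lower_nd.
  exists 1 => _ [n _ <-]; have /andP[_ +] := iter_bound n s.
  have : 0 <= C * r ^+ n by apply: mulr_ge0; [|apply: exprn_ge0]; exact: ltW.
  lra.
move=> /cvg_ex[l cl]; apply/cvg_ex; exists (l + 0).
apply: cvg_trans (cvgD cl Crn); apply: near_eq_cvg.
by apply: nearW => n /=; rewrite subrK.
Qed.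

Lemma derham_dist n s : `|derham s - derham_iter n s| <= C * r ^+ n.
Proof.
have cl : (fun n => derham_iter n s - C * r ^+ n) @ \oo --> derham s.
  by rewrite -[derham s]subr0; apply: cvgB Crn; exact: derham_cvg.
have cu : (fun n => derham_iter n s + C * r ^+ n) @ \oo --> derham s.
  by rewrite -[derham s]addr0; apply: cvgD Crn; exact: derham_cvg.
have := nondecreasing_cvgn_le (lower_nd s) (cvgP _ cl) n.
have := nonincreasing_cvgn_ge (upper_ni s) (cvgP _ cu) n.
rewrite (cvg_lim (@Rhausdorff R) cl) (cvg_lim (@Rhausdorff R) cu).
by move=> *; rewrite ler_norml; apply/andP; split; lra.
Qed.

Lemma derhamE s :
  derham s = (1 - rho) * derham (2 * s) + rho * (1 - derham (2 - 2 * s)).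
Proof.
have lhs : derham_iter n.+1 s @[n --> \oo] --> derham s.
  by rewrite (cvg_shiftS (derham_iter ^~ s)); exact: derham_cvg.
rewrite -(cvg_lim (@Rhausdorff R) lhs); apply: (cvg_lim (@Rhausdorff R)).
apply: cvgD; apply: cvgMr; first exact: derham_cvg.
by apply: cvgB; [exact: cvg_cst|exact: derham_cvg].
Qed.

Lemma ramp_derham : ramp derham.
Proof.
split => s s0; apply: (cvg_lim (@Rhausdorff R)).
  under eq_fun do rewrite (ramp_iter _).1 //.
  exact: cvg_cst.
under eq_fun do rewrite (ramp_iter _).2 //.
exact: cvg_cst.
Qed.

Lemma continuous_iter n : continuous (derham_iter n).
Proof.
elim: n => [|n IH] s.
  have : {for s, continuous (cst 0 \max (id \min cst 1) : R -> R^o)}.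
    apply: continuous_max; first exact: cvg_cst.
    by apply: continuous_min; [exact: cvg_id|exact: cvg_cst].
  by [].
apply: cvgD; apply: cvgMr.
  apply: (@continuous_comp _ _ _ (fun s => 2 * s)); last exact: IH.
  by apply: cvgMr; exact: cvg_id.
apply: cvgB; first exact: cvg_cst.
apply: (@continuous_comp _ _ _ (fun s => 2 - 2 * s)); last exact: IH.
by apply: cvgB; [exact: cvg_cst|apply: cvgMr; exact: cvg_id].
Qed.

(** A uniform limit of continuous functions, the rate being [derham_dist]. *)
Lemma derham_continuous : continuous derham.
Proof.
move=> s; apply/cvgrPdist_lt => e e0.
have e3 : 0 < e / 3 by lra.
have /cvgrPdist_lt/(_ _ e3)[n _ /(_ n (leqnn n))] := Crn.
rewrite sub0r normrN => Cn.
have {}Cn : C * r ^+ n < e / 3 := le_lt_trans (ler_norm _) Cn.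
have := @continuous_iter n s; move=> /cvgrPdist_lt/(_ _ e3).
apply: filterS => y yn.
have := derham_dist n s; have := derham_dist n y.
move: yn; rewrite !ltr_norml !ler_norml => /andP[a1 a2] /andP[b1 b2] /andP[d1 d2].
by apply/andP; split; lra.
Qed.


(** The lower bound -1 leaves room on the left of 0, so that the function is
    also differentiable at 0; it vanishes on the negative half-line because
    the integrand does. *)
Definition derham_int s : R := \int[lebesgue_measure]_(t in `[-1, s]) derham t.

Lemma derham_int_le0 s : s <= 0 -> derham_int s = 0.
Proof.
move=> s0; rewrite /derham_int /Rintegral (eq_integral (cst 0%E)) ?integral0//.
move=> t /set_mem; rewrite /= in_itv/= => /andP[_ ts].
by rewrite ramp_derham.1 //; exact: le_trans ts s0.
Qed.

Lemma is_derive_derham_int s : is_derive s 1 derham_int (derham s).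
Proof.
have [s0|s0] := ltP s 0.
  rewrite ramp_derham.1; last exact: ltW.
  apply: (@near_eq_is_derive _ _ _ (cst 0)).
  by near=> t; rewrite derham_int_le0 //; apply: ltW; near: t; exact: lt_nbhsl.
have sm1 : -1 < s by apply: lt_le_trans s0; rewrite ltrN10.
have [] := @continuous_FTC1_closed R derham (-1) s (s + 1).
- by rewrite ltrDl.
- apply: continuous_compact_integrable; first exact: segment_compact.
  by apply: continuous_subspaceT => t; exact: derham_continuous.
- exact: sm1.
- exact: derham_continuous.
by rewrite -/derham_int derive1E => ds dE; apply: DeriveDef.
Unshelve. all: by end_near. Qed.

Lemma is_derive_affine (c k : R) g s (dg : R) : is_derive (c * s + k) 1 g dg ->
  is_derive s 1 (fun t => g (c * t + k)) (c * dg).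
Proof.
move=> /is_derive1_caratheodory[u [ug cu <-]]; apply/is_derive1_caratheodory.
exists (fun t => c * u (c * t + k)); split => //.
  by move=> t; rewrite ug; ring.
apply: cvgMr; apply: (@continuous_comp _ _ _ (fun t => c * t + k)) => //.
by apply: cvgD; [apply: cvgMr; exact: cvg_id|exact: cvg_cst].
Qed.

Let sigma := derham_int 1.

Lemma derham_int_ge1 s : 1 <= s -> derham_int s = sigma + (s - 1).
Proof.
move=> s1; rewrite /sigma; have [->|s1'] := eqVneq s 1; first by rewrite subrr addr0.
have lts : 1 < s by rewrite lt_neqAle eq_sym s1'.
have [||c] := @MVT R derham_int derham _ _ lts.
- by move=> t _; exact: is_derive_derham_int.
- apply: derivable_within_continuous => t _.
  by have [] := is_derive_derham_int t.
rewrite in_itv/= => /andP[c1 _].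
rewrite ramp_derham.2 ?ltW // => H.
by rewrite -(subrK (derham_int 1) (derham_int s)) H mul1r addrC.
Qed.

(** The functional equation [derhamE] integrated from 0: both sides have the
    same derivative and vanish at 0. *)
Lemma derham_intE s : derham_int s =
  (1 - rho) / 2 * derham_int (2 * s) + rho * s +
  rho / 2 * (derham_int (2 - 2 * s) - sigma - 1).
Proof.
pose D := derham_int - ((1 - rho) / 2 *: (fun s => derham_int (2 * s + 0)) + rho *: id +
  rho / 2 *: ((fun s => derham_int (- 2 * s + 2)) - cst (sigma + 1))).
have D0 (t : R) : is_derive t 1 (D : R -> R) 0.
  have d1 := @is_derive_affine 2 0 _ t _ (is_derive_derham_int _).
  have d2 := @is_derive_affine (- 2) 2 _ t _ (is_derive_derham_int _).
  have d0 := is_derive_derham_int t.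
  apply: is_derive_eq.
  rewrite [derham t]derhamE (_ : - 2 * t + 2 = 2 - 2 * t) ?addr0; last ring.
  by rewrite /GRing.scale/=; field.
have := is_derive_0_is_cst s 0 D0; rewrite /D !fctE /GRing.scale/=.
rewrite (_ : - 2 * s + 2 = 2 - 2 * s); last ring.
rewrite (_ : - 2 * 0 + 2 = 2); last ring.
rewrite !mulr0 !addr0 (derham_int_le0 (lexx 0)) [derham_int 2]derham_int_ge1; last lra.
by move=> H; lra.
Qed.

(** The functional equation at 1 is a linear equation for this integral. *)
Lemma derham_int1 : sigma = 1 / (1 + 2 * rho).
Proof.
have := derham_intE 1; rewrite -/sigma !mulr1 subrr (derham_int_le0 (lexx 0)).
rewrite (derham_int_ge1 (s := 2)); last lra.
move=> H; have rho2 : 1 + 2 * rho != 0.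
  by rewrite gt_eqF //; have := rho0; lra.
apply: (mulIf rho2); rewrite divfK //.
by lra.
Qed.

End DeRham.

(** * The Merrien spaces on one interval *)

Section Dyadic.
Variable R : realType.
Implicit Types p q u v t : R.

Lemma dyadic_sub_itv p q u v : p < q -> dyadic_sub p q u v ->
  [/\ p <= u, u < v & v <= q].
Proof.
by move=> pq; elim=> [|{}u {}v _ [pu uv vq]|{}u {}v _ [pu uv vq]];
  rewrite /mid; split; lra.
Qed.

Lemma dyadic_sub_around p q t n : p < q -> t \in `[p, q] ->
  exists u v, [/\ dyadic_sub p q u v, u <= t <= v & v - u = (q - p) / 2 ^+ n].
Proof.
move=> pq; rewrite in_itv/= => tpq; elim: n => [|n [u [v [duv /andP[ut tv] uvE]]]].
  by exists p, q; split; [exact: dyadic_self| |rewrite expr0 divr1].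
have h2 : (q - p) / 2 ^+ n.+1 = (v - u) / 2.
  by rewrite uvE exprS invfM mulrCA mulrC.
have [tm|mt] := leP t (mid u v).
  exists u, (mid u v); split; [exact: dyadic_left|by rewrite ut|].
  by rewrite h2 /mid; field.
exists (mid u v), v; split; [exact: dyadic_right|by rewrite ltW|].
by rewrite h2 /mid; field.
Qed.

Lemma dyadic_sub_near p q t e : p < q -> t \in `[p, q] -> 0 < e ->
  exists u v, dyadic_sub p q u v /\ `|t - u| < e.
Proof.
move=> pq tpq e0.
have [n ne] : exists n, (q - p) / 2 ^+ n < e.
  exists (Num.bound ((q - p) / e)); set n := Num.bound _.
  rewrite ltr_pdivrMr ?exprn_gt0// mulrC -ltr_pdivrMr//.
  have qp0 : 0 <= (q - p) / e by apply: divr_ge0; lra.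
  apply: lt_trans (archi_boundP qp0) _.
  by rewrite -natrX ltr_nat ltn_expl.
have [u [v [duv /andP[ut tv] uvE]]] := dyadic_sub_around n pq tpq.
exists u, v; split => //; rewrite ger0_norm ?subr_ge0//.
by apply: le_lt_trans ne; rewrite -uvE lerB.
Qed.

End Dyadic.

Section Merrien.
Variables (R : realType) (beta : R).
Hypothesis beta_itv : -1 <= beta /\ beta < 0.
Implicit Types (f g : R -> R) (p q u v t : R).

Let theta := theta_of beta.
Let rho := - beta / 2.
Let S := derham rho.
Let F := derham_int rho.

Let bN1 : beta - 1 != 0. Proof. by move: beta_itv => [? ?]; rewrite lt_eqF //; lra. Qed.
Let bN2 : 1 - beta != 0. Proof. by move: beta_itv => [? ?]; rewrite gt_eqF //; lra. Qed.

(** The parameter range used throughout: theta > 0 makes B-coefficients encode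
    derivatives, and theta <= 1 / 4 makes corner cutting a convex combination. *)
Lemma theta_itv : 0 < theta <= 1 / 4.
Proof.
have [b1 b0] := beta_itv.
have -> : theta = 1 / 2 * (- beta / (1 - beta)).
  by rewrite /theta /theta_of; field; rewrite bN1 bN2.
rewrite mulrA; apply/andP; split.
  by apply: divr_gt0; lra.
by rewrite ler_pdivrMr; lra.
Qed.

Let th0 : 0 < theta. Proof. by have /andP[] := theta_itv. Qed.
Let th_neq0 : theta != 0. Proof. by rewrite gt_eqF. Qed.
Let th1 : 0 < 1 - 2 * theta. Proof. by have /andP[] := theta_itv; lra. Qed.
Let th1_neq0 : 1 - 2 * theta != 0. Proof. by rewrite gt_eqF. Qed.

Let rho0 : 0 < rho. Proof. by rewrite /rho; move: beta_itv => [? ?]; lra. Qed.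
Let rho1 : rho < 1. Proof. by rewrite /rho; move: beta_itv => [? ?]; lra. Qed.

Let F0 : F 0 = 0. Proof. exact: derham_int_le0. Qed.
Let F1 : F 1 = 1 - 2 * theta.
Proof.
rewrite /F derham_int1 // /theta /theta_of /rho.
rewrite (_ : 1 + 2 * (- beta / 2) = 1 - beta); last by field.
by field; rewrite bN1 bN2.
Qed.
Let Fge1 s : 1 <= s -> F s = s - 2 * theta.
Proof. by move=> s1; rewrite /F derham_int_ge1 // -/F F1; ring. Qed.
Let FE s : F s = (1 - rho) / 2 * F (2 * s) + rho * s +
  rho / 2 * (F (2 - 2 * s) - 2 + 2 * theta).
Proof. by rewrite {1}/F derham_intE // -/F F1; ring. Qed.
Let Sle0 s : s <= 0 -> S s = 0. Proof. by have [S0 _] := ramp_derham rho; exact: S0. Qed.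
Let Sge1 s : 1 <= s -> S s = 1. Proof. by have [_ S1] := ramp_derham rho; exact: S1. Qed.
Let SE s : S s = (1 - rho) * S (2 * s) + rho * (1 - S (2 - 2 * s)).
Proof. exact: derhamE. Qed.

(** The general element of V(beta) on [u, v]. The arguments of F take values in
    [0, 2]: on the half of [u, v] where F (2 (t - u) / (v - u)) is not an affine
    function of t, the other term F (2 (v - t) / (v - u)) is, and conversely. *)
Definition derham_comb u v (al be ga de : R) t :=
  al + be * t + ga * F (2 * (t - u) / (v - u)) + de * F (2 * (v - t) / (v - u)).

(** The formal derivative of [derham_comb] in t, since S is the derivative of F. *)
Definition derham_comb' u v (be ga de : R) t :=
  be + 2 * ga / (v - u) * S (2 * (t - u) / (v - u)) -
  2 * de / (v - u) * S (2 * (v - t) / (v - u)).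

(** f and its derivative g share their parameters, because the Merrien relations
    for either of them involve both. *)
Definition derham_form u v f g := exists al be ga de, forall t, u <= t <= v ->
  f t = derham_comb u v al be ga de t /\ g t = derham_comb' u v be ga de t.

(** On the left half, the de-term is affine and [derham_intE] expands the
    ga-term into the two generators of that half and an affine function. *)
Lemma derham_form_left u v f g : u < v ->
  derham_form u v f g -> derham_form u (mid u v) f g.
Proof.
move=> uv [al [be [ga [de fgE]]]].
have h0 : v - u != 0 by rewrite gt_eqF // subr_gt0.
(* k collects the slopes: rho s from the ga-term and - s from the de-term,
   with s = 2 (t - u) / (v - u). *)
pose k := (ga * rho - de) * 2 / (v - u).
exists (al + de * (2 - 2 * theta) - ga * rho / 2 * (2 - 2 * theta) - k * u).
exists (be + k), (ga * (1 - rho) / 2), (ga * rho / 2) => t /andP[ut tm].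
have [-> ->] : f t = derham_comb u v al be ga de t /\ g t = derham_comb' u v be ga de t.
  by apply: fgE; rewrite ut /= (le_trans tm) // /mid; lra.
have hm : mid u v - u = (v - u) / 2 by rewrite /mid; field.
pose s := 2 * (t - u) / (v - u).
have s1 : s <= 1.
  by rewrite /s ler_pdivrMr ?subr_gt0 //; move: tm; rewrite /mid; lra.
rewrite /derham_comb /derham_comb' hm.
rewrite (_ : 2 * (v - t) / (v - u) = 2 - s); last by rewrite /s; field.
rewrite (_ : 2 * (t - u) / ((v - u) / 2) = 2 * s); last by rewrite /s; field.
rewrite (_ : 2 * (mid u v - t) / ((v - u) / 2) = 2 - 2 * s); last first.
  by rewrite /s /mid; field.
rewrite -/s (FE s) (SE s) (@Fge1 (2 - s)) ?(@Sge1 (2 - s)); [|lra..].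
by rewrite /k; split; [rewrite /s|]; field.
Qed.

(** Mirror image of [derham_form_left]: the roles of ga and de are exchanged. *)
Lemma derham_form_right u v f g : u < v ->
  derham_form u v f g -> derham_form (mid u v) v f g.
Proof.
move=> uv [al [be [ga [de fgE]]]].
have h0 : v - u != 0 by rewrite gt_eqF // subr_gt0.
pose k := (de * rho - ga) * 2 / (v - u).
exists (al + ga * (2 - 2 * theta) - de * rho / 2 * (2 - 2 * theta) + k * v).
exists (be - k), (de * rho / 2), (de * (1 - rho) / 2) => t /andP[mt tv].
have [-> ->] : f t = derham_comb u v al be ga de t /\ g t = derham_comb' u v be ga de t.
  by apply: fgE; rewrite tv andbT (le_trans _ mt) // /mid; lra.
have hm : v - mid u v = (v - u) / 2 by rewrite /mid; field.
pose s := 2 * (v - t) / (v - u).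
have s1 : s <= 1.
  by rewrite /s ler_pdivrMr ?subr_gt0 //; move: mt; rewrite /mid; lra.
rewrite /derham_comb /derham_comb' hm.
rewrite (_ : 2 * (t - u) / (v - u) = 2 - s); last by rewrite /s; field.
rewrite (_ : 2 * (v - t) / ((v - u) / 2) = 2 * s); last by rewrite /s; field.
rewrite (_ : 2 * (t - mid u v) / ((v - u) / 2) = 2 - 2 * s); last first.
  by rewrite /s /mid; field.
rewrite -/s (FE s) (SE s) (@Fge1 (2 - s)) ?(@Sge1 (2 - s)); [|lra..].
by rewrite /k; split; [rewrite /s|]; field.
Qed.

Lemma derham_form_dyadic p q u v f g : p < q -> derham_form p q f g ->
  dyadic_sub p q u v -> derham_form u v f g.
Proof.
move=> pq fg; elim=> // {}u {}v /(dyadic_sub_itv pq)[_ uv _].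
  exact: derham_form_left.
exact: derham_form_right.
Qed.

Lemma derham_comb_ends u v al be ga de : u < v ->
  [/\ derham_comb u v al be ga de u = al + be * u + de * (2 - 2 * theta),
      derham_comb' u v be ga de u = be - 2 * de / (v - u),
      derham_comb u v al be ga de v = al + be * v + ga * (2 - 2 * theta) &
      derham_comb' u v be ga de v = be + 2 * ga / (v - u)].
Proof.
move=> uv; have h0 : v - u != 0 by rewrite gt_eqF // subr_gt0.
rewrite /derham_comb /derham_comb' !subrr mulr0 mul0r mulfK // F0.
rewrite (Sle0 (lexx 0)) (@Sge1 2) ?(@Fge1 2); [|lra..].
by split; ring.
Qed.

(** The values of F and S at 0, 1 and 2 suffice, since these are the arguments
    that occur at u, at v and at the midpoint. *)
Lemma derham_form_merrien u v f g : u < v -> derham_form u v f g ->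
  f (mid u v) = 1 / 2 * (f u + f v - theta * (v - u) * (g v - g u)) /\
  g (mid u v) = 1 / (1 - 2 * theta) *
    ((f v - f u) / (v - u) - 2 * theta * ((g u + g v) / 2)).
Proof.
move=> uv [al [be [ga [de fgE]]]].
have h0 : v - u != 0 by rewrite gt_eqF // subr_gt0.
have [f0 g0 f1 g1] := derham_comb_ends al be ga de uv.
have [-> ->] : f u = derham_comb u v al be ga de u /\ g u = derham_comb' u v be ga de u.
  by apply: fgE; rewrite lexx ltW.
have [-> ->] : f v = derham_comb u v al be ga de v /\ g v = derham_comb' u v be ga de v.
  by apply: fgE; rewrite lexx ltW.
have [-> ->] : f (mid u v) = derham_comb u v al be ga de (mid u v) /\
    g (mid u v) = derham_comb' u v be ga de (mid u v).
  by apply: fgE; rewrite /mid; lra.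
rewrite f0 g0 f1 g1 /derham_comb /derham_comb'.
rewrite (_ : 2 * (mid u v - u) / (v - u) = 1); last by rewrite /mid; field.
rewrite (_ : 2 * (v - mid u v) / (v - u) = 1); last by rewrite /mid; field.
rewrite F1 (@Sge1 1) // /mid; split; field => //.
by rewrite h0.
Qed.

Lemma is_derive_derham_comb u v al be ga de t :
  is_derive t 1 (derham_comb u v al be ga de) (derham_comb' u v be ga de t).
Proof.
have dL := @is_derive_affine R (2 / (v - u)) (- (2 / (v - u) * u)) F t _
  (is_derive_derham_int rho0 rho1 _).
have dR := @is_derive_affine R (- (2 / (v - u))) (2 / (v - u) * v) F t _
  (is_derive_derham_int rho0 rho1 _).
rewrite (_ : derham_comb u v al be ga de = cst al + be *: id +
   ga *: (fun t => F (2 / (v - u) * t + - (2 / (v - u) * u))) +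
   de *: (fun t => F (- (2 / (v - u)) * t + (2 / (v - u) * v)))).
  apply: is_derive_eq; rewrite /derham_comb' /GRing.scale/= -/S.
  rewrite (_ : 2 / (v - u) * t - (2 / (v - u) * u) = 2 * (t - u) / (v - u)); last ring.
  rewrite (_ : - (2 / (v - u)) * t + (2 / (v - u) * v) = 2 * (v - t) / (v - u)); last ring.
  by ring.
apply/funext => s; rewrite /derham_comb !fctE /GRing.scale/=.
by congr (_ + _ * F _ + _ * F _); ring.
Qed.

Lemma derham_comb'_continuous u v be ga de : continuous (derham_comb' u v be ga de).
Proof.
have cS := derham_continuous rho0 rho1.
move=> t; rewrite /derham_comb'; apply: cvgB; [apply: cvgD; [exact: cvg_cst|]|];
  apply: cvgMr.
- apply: (@continuous_comp _ _ _ (fun t => 2 * (t - u) / (v - u))); last exact: cS.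
  by apply: cvgMl; apply: cvgMr; apply: cvgB; [exact: cvg_id|exact: cvg_cst].
- apply: (@continuous_comp _ _ _ (fun t => 2 * (v - t) / (v - u))); last exact: cS.
  by apply: cvgMl; apply: cvgMr; apply: cvgB; [exact: cvg_cst|exact: cvg_id].
Qed.

Lemma merrien_derham_comb p q al be ga de : p < q ->
  merrien_space beta p q (derham_comb p q al be ga de) /\
  forall t, t \in `[p, q] -> derive_on `[p, q] (derham_comb p q al be ga de) t =
     derham_comb' p q be ga de t.
Proof.
move=> pq; set f := derham_comb _ _ _ _ _ _; set g := derham_comb' _ _ _ _ _.
have df t : t \in `[p, q] -> has_derive_on `[p, q] f t (g t).
  by move=> _; apply: is_derive_has_derive_on; exact: is_derive_derham_comb.
have fE t : t \in `[p, q] -> derive_on `[p, q] f t = g t.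
  by move=> tpq; apply: has_derive_onE => //; exact: df.
split => //; split.
  apply: C1_onI df _ => //.
  by apply: continuous_subspaceT; exact: derham_comb'_continuous.
move=> u v duv; have [pu uv vq] := dyadic_sub_itv pq duv.
rewrite (fE u) ?(fE v) ?(fE (mid u v)); first last;
  [by rewrite in_itv/= /mid; lra..|].
apply: derham_form_merrien => //; apply: derham_form_dyadic duv => //.
by exists al, be, ga, de.
Qed.

(** The coefficients prescribe f and f' at both ends, four linear conditions on
    the four parameters of [derham_comb], and these are uniquely solvable. *)
Lemma merrien_exists p q (c0 c1 c2 c3 : R) : p < q ->
  exists f, merrien_space beta p q f /\ bcoefs beta p q f = [:: c0; c1; c2; c3].
Proof.
move=> pq; have h0 : q - p != 0 by rewrite gt_eqF // subr_gt0.
(* A and B are the prescribed derivatives at p and q. *)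
pose A := (c1 - c0) / (theta * (q - p)).
pose B := (c3 - c2) / (theta * (q - p)).
(* be solves (f q - f p) / (q - p) = (2 - 2 theta) (A + B) / 2 - (1 - 2 theta) be,
   where 2 - 2 theta = F 2 and de, ga are eliminated by f' p = A, f' q = B. *)
pose be := ((2 - 2 * theta) * (A + B) / 2 - (c3 - c0) / (q - p)) / (1 - 2 * theta).
pose de := (be - A) * (q - p) / 2.
pose ga := (B - be) * (q - p) / 2.
pose al := c0 - be * p - de * (2 - 2 * theta).
have [fV dE] := merrien_derham_comb al be ga de pq.
exists (derham_comb p q al be ga de); split => //.
have [f0 g0 f1 g1] := derham_comb_ends al be ga de pq.
rewrite /bcoefs (dE p) ?(dE q); [|by rewrite in_itv/=; lra..].
rewrite f0 g0 f1 g1 -/theta /al /ga /de /be /A /B.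
by congr [:: _; _; _; _]; field; rewrite ?h0 ?th_neq0 ?th1_neq0.
Qed.

Lemma merrien_lin p q f g (c : R) : p < q -> merrien_space beta p q f ->
  merrien_space beta p q g -> merrien_space beta p q (c *: f + g).
Proof.
move=> pq [fC fV] [gC gV]; split; first exact: C1_on_lin.
move=> u v duv; have [pu uv vq] := dyadic_sub_itv pq duv.
have h0 : v - u != 0 by rewrite gt_eqF // subr_gt0.
have [fm dfm] := fV _ _ duv; have [gm dgm] := gV _ _ duv.
rewrite !derive_on_lin //; [|by rewrite in_itv/= /mid; lra..].
rewrite !fctE /GRing.scale/= fm dfm gm dgm -/theta.
by split; field; rewrite ?h0 ?th1_neq0.
Qed.

Lemma bcoefs_lin p q f g (c : R) j : p < q -> merrien_space beta p q f ->
  merrien_space beta p q g ->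
  (bcoefs beta p q (c *: f + g))`_j =
  c * (bcoefs beta p q f)`_j + (bcoefs beta p q g)`_j.
Proof.
move=> pq [fC _] [gC _]; rewrite /bcoefs.
rewrite !derive_on_lin //; [|by rewrite in_itv/=; lra..].
rewrite !fctE /GRing.scale/=.
by case: j => [|[|[|[|j]]]] /=; rewrite ?nth_nil; ring.
Qed.

Lemma merrien_eq p q f g : p < q -> (forall t, t \in `[p, q] -> f t = g t) ->
  merrien_space beta p q f ->
  merrien_space beta p q g /\ bcoefs beta p q g = bcoefs beta p q f.
Proof.
move=> pq fg [fC fV]; have gC := C1_on_eq pq fg fC.
have dE t : t \in `[p, q] -> derive_on `[p, q] g t = derive_on `[p, q] f t.
  move=> tpq; apply: has_derive_onE => //.
  exact: (has_derive_on_eq _ tpq (C1_on_derive fC tpq)).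
have pI : p \in `[p, q] by rewrite in_itv/=; lra.
have qI : q \in `[p, q] by rewrite in_itv/=; lra.
split; last by rewrite /bcoefs (dE p) // (dE q) // !fg.
split => // u v duv; have [pu uv vq] := dyadic_sub_itv pq duv.
rewrite (dE u) ?(dE v) ?(dE (mid u v)) -?fg; first exact: fV.
all: by rewrite in_itv/= /mid; lra.
Qed.

Lemma merrien_cst p q (c : R) : p < q ->
  merrien_space beta p q (cst c) /\ bcoefs beta p q (cst c) = [:: c; c; c; c].
Proof.
move=> pq.
have d0 t : t \in `[p, q] -> has_derive_on `[p, q] (cst c) t 0.
  by move=> _; apply: is_derive_has_derive_on; exact: is_derive_cst.
have dE t : t \in `[p, q] -> derive_on `[p, q] (cst c) t = 0.
  by move=> tpq; apply: has_derive_onE => //; exact: d0.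
split; last first.
  rewrite /bcoefs !dE; [|by rewrite in_itv/=; lra..].
  by rewrite /cst mulr0 addr0 subr0.
split; first by apply: C1_onI d0 _ => //; apply: continuous_subspaceT => t; exact: cvg_cst.
move=> u v duv; have [pu uv vq] := dyadic_sub_itv pq duv.
rewrite !dE; [|by rewrite in_itv/= /mid; lra..].
rewrite /cst !(subrr, mul0r, addr0, mulr0, subr0); split => //; lra.
Qed.

(** Induction along bisection: each new B-coefficient is a convex combination of
    the old ones, with weights 1 / 2 or (1 +- r) / 2 where
    r = theta / (1 - 2 theta) <= 1. *)
Lemma merrien_corner_cutting p q f u v : p < q -> merrien_space beta p q f ->
  (forall j, 0 <= (bcoefs beta p q f)`_j) -> dyadic_sub p q u v ->
  let f' := derive_on `[p, q] f in
  [/\ 0 <= f u, 0 <= f u + theta * (v - u) * f' u,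
      0 <= f v - theta * (v - u) * f' v & 0 <= f v].
Proof.
move=> pq [_ fV] c0 duv f'; elim: duv => [|{}u {}v duv|{}u {}v duv].
- by split; [exact: (c0 0)|exact: (c0 1)|exact: (c0 2)|exact: (c0 3)].
all: move=> [a0 a1 a2 a3]; have [pu uv vq] := dyadic_sub_itv pq duv.
all: have [fm dfm] := fV _ _ duv; rewrite -/f' -/theta in fm dfm.
all: have hm : mid u v - u = (v - u) / 2 by rewrite /mid; field.
all: have hm' : v - mid u v = (v - u) / 2 by rewrite /mid; field.
all: have h0 : v - u != 0 by rewrite gt_eqF // subr_gt0.
all: have /andP[_ th4] := theta_itv.
all: pose b1 := f u + theta * (v - u) * f' u.
all: pose b2 := f v - theta * (v - u) * f' v.
all: have fm2 : f (mid u v) = (b1 + b2) / 2 by rewrite fm /b1 /b2; field.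
all: pose r := theta / (1 - 2 * theta).
all: have r0 : 0 < r by apply: divr_gt0.
all: have r1 : r < 1 by rewrite /r ltr_pdivrMr //; lra.
all: have dm : theta * ((v - u) / 2) * f' (mid u v) = r / 2 * (b2 - b1).
1,3: by rewrite dfm /r /b1 /b2; field; rewrite h0 th1_neq0.
all: rewrite -/b1 -/b2 in a1 a2.
all: have e1 : 0 <= (1 - r) * b1 by apply: mulr_ge0 => //; rewrite subr_ge0 ltW.
all: have e2 : 0 <= (1 - r) * b2 by apply: mulr_ge0 => //; rewrite subr_ge0 ltW.
all: have e3 : 0 <= r * b1 by apply: mulr_ge0 => //; rewrite ltW.
all: have e4 : 0 <= r * b2 by apply: mulr_ge0 => //; rewrite ltW.
- rewrite hm dm fm2; split => //; [|lra..].
  by move: a1; rewrite /b1; lra.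
- rewrite hm' dm fm2; split => //; [lra..|].
  by move: a2; rewrite /b2; lra.
Qed.

(** A negative value would persist on a neighborhood, which contains an endpoint
    of a dyadic subinterval, where f is a B-coefficient. *)
Lemma merrien_ge0 p q f : p < q -> merrien_space beta p q f ->
  (forall j, 0 <= (bcoefs beta p q f)`_j) -> forall t, t \in `[p, q] -> 0 <= f t.
Proof.
move=> pq fV c0 t tpq; rewrite leNgt; apply/negP => ft0.
have /subspace_continuousP/(_ t tpq) := C1_on_continuous fV.1.
have : 0 < - f t by lra.
move=> /[swap] /cvgrPdist_lt /[apply].
rewrite near_withinE => /nbhs_ballP[e/= e0 te].
have [u [v [duv tue]]] := dyadic_sub_near pq tpq e0.
have [pu uv vq] := dyadic_sub_itv pq duv.
have [fu0 _ _ _] := merrien_corner_cutting pq fV c0 duv.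
have upq : u \in `[p, q] by rewrite in_itv/=; lra.
have := te u tue upq; rewrite ltr_norml => /andP[+ _].
by rewrite -[X in _ < X - _]/(f t) -[X in _ < _ - X]/(f u); lra.
Qed.

Lemma merrien_unique p q f g : p < q -> merrien_space beta p q f ->
  merrien_space beta p q g -> bcoefs beta p q f = bcoefs beta p q g ->
  forall t, t \in `[p, q] -> f t = g t.
Proof.
move=> pq.
have le f1 g1 : merrien_space beta p q f1 -> merrien_space beta p q g1 ->
    bcoefs beta p q f1 = bcoefs beta p q g1 -> forall t, t \in `[p, q] -> f1 t <= g1 t.
  move=> fV gV fg t tpq; have := merrien_ge0 pq (merrien_lin (-1) pq fV gV).
  move=> /(_ _ t tpq); rewrite !fctE /GRing.scale/= mulN1r => H.
  rewrite -subr_ge0 addrC; apply: H => j.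
  by rewrite bcoefs_lin // fg mulN1r addNr.
move=> fV gV fg t tpq; apply/eqP; rewrite eq_le.
by rewrite (le f g) ?(le g f).
Qed.

End Merrien.

(** * B-coefficients of splines *)

Section Coefficients.
Variables (R : realType) (n : nat) (x beta : nat -> R).
Implicit Types (d e : nat -> R) (i k : nat).

(** Value at the i-th knot of the spline with coordinates d. At interior knots
    it is the convex combination that makes the derivative continuous there,
    see [derive_match]. *)
Definition knot_value d i : R :=
  if i == 0%N then d 0%N else if i == n then d (2 * n + 1)%N
  else omega x beta i * d (2 * i)%N + (1 - omega x beta i) * d (2 * i + 1)%N.

Definition spline_bcoefs d i : seq R :=
  [:: knot_value d i.-1; d (2 * i.-1 + 1)%N; d (2 * i)%N; knot_value d i].

Lemma knot_value_lin d e (c : R) i :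
  knot_value (fun k => c * d k + e k) i = c * knot_value d i + knot_value e i.
Proof. by rewrite /knot_value; do 2?[case: ifP => _ //]; ring. Qed.

Lemma spline_bcoefs_lin d e (c : R) i j :
  (spline_bcoefs (fun k => c * d k + e k) i)`_j =
  c * (spline_bcoefs d i)`_j + (spline_bcoefs e i)`_j.
Proof.
rewrite /spline_bcoefs !knot_value_lin.
by case: j => [|[|[|[|j]]]] //=; rewrite nth_nil mulr0 addr0.
Qed.

Lemma eq_spline_bcoefs d e i : (1 <= i <= n)%N ->
  (forall k, (k < 2 * n + 2)%N -> d k = e k) -> spline_bcoefs d i = spline_bcoefs e i.
Proof.
move=> /andP[i1 iln] de; rewrite /spline_bcoefs /knot_value.
have -> : d (2 * i)%N = e (2 * i)%N by apply: de; lia.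
have -> : d 0%N = e 0%N by apply: de; lia.
have -> : d (2 * n + 1)%N = e (2 * n + 1)%N by apply: de; lia.
have -> : d (2 * i.-1)%N = e (2 * i.-1)%N by apply: de; lia.
have -> : d (2 * i.-1 + 1)%N = e (2 * i.-1 + 1)%N by apply: de; lia.
have [->//|/eqP iNn] := eqVneq i n.
by have -> : d (2 * i + 1)%N = e (2 * i + 1)%N by apply: de; lia.
Qed.

Lemma spline_bcoefs_inj d e : (1 <= n)%N ->
  (forall i, (1 <= i <= n)%N -> spline_bcoefs d i = spline_bcoefs e i) ->
  forall k, (k < 2 * n + 2)%N -> d k = e k.
Proof.
move=> n1 de k kn.
have [->|k0] := eqVneq k 0%N.
  by case: (de 1%N n1).
have [->|kN] := eqVneq k (2 * n + 1)%N.
  have nn : (1 <= n <= n)%N by rewrite n1 leqnn.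
  by case: (de n nn) => _ _ _; rewrite /knot_value eqxx; case: eqP => // n0; lia.
have := odd_double_half k; case: (odd k) => kE.
  have iN : (1 <= k./2.+1 <= n)%N by lia.
  have kE' : (2 * k./2.+1.-1 + 1 = k)%N by lia.
  by have := congr1 (nth 0 ^~ 1%N) (de _ iN); rewrite /spline_bcoefs kE'.
have iN : (1 <= k./2 <= n)%N by lia.
have kE' : (2 * k./2 = k)%N by lia.
by have := congr1 (nth 0 ^~ 2%N) (de _ iN); rewrite /spline_bcoefs kE'.
Qed.

(* Case splits are restricted to the index tests that lia cannot decide. *)
Local Ltac decide_nat_eqs :=
  repeat match goal with |- context [(?a == ?b) :> nat] =>
    first [ have -> : (a == b) = false by lia
          | have -> : (a == b) = true by lia
          | case: (eqVneq a b) => ? ] end.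

(** Replaces the table by a list that is linear in the coordinates, so that
    combinations of B-splines are handled by linearity instead of by cases. *)
Lemma bspline_bcoefsE k i : (1 <= i <= n)%N -> (k < 2 * n + 2)%N ->
  bspline_bcoefs n x beta k i = spline_bcoefs (fun j => (j == k)%:R) i.
Proof.
case: i => // i /= iN kN.
rewrite /bspline_bcoefs /spline_bcoefs /knot_value succnK.
have := odd_double_half k; move: (odd k) k./2 => [] j /= kE.
all: decide_nat_eqs; try match goal with H : _.+1 = _.+1 |- _ => case: H => H end.
all: by subst; rewrite ?mulr0 ?mulr1 ?addr0 ?add0r.
Qed.

End Coefficients.

(** * The spline space *)

Lemma knot_itv_cover (R : realType) (x : nat -> R) m t : (1 <= m)%N -> t \in `[x 0%N, x m] ->
  exists i, (1 <= i <= m)%N /\ t \in `[x i.-1, x i].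
Proof.
case: m => // m _; elim: m => [|m IH] tm; first by exists 1%N.
have [tl|tl] := leP t (x m.+1).
  have [|i [im ti]] := IH; last by exists i; split => //; lia.
  by move: tm; rewrite !in_itv/= tl andbT => /andP[].
exists m.+2; split; first lia.
by move: tm; rewrite !in_itv/= (ltW tl) => /andP[].
Qed.

(** Coordinate families are indexed by nat, so that indices such as 2 i + 1 need
    no bound; this reconciles them with families indexed by ordinals. *)
Lemma extend_ord (R : nmodType) m (c : 'I_m -> R) :
  exists d : nat -> R, forall k : 'I_m, c k = d k.
Proof. by exists (fun k => oapp c 0 (insub k)) => k; rewrite valK. Qed.

Section SplineSpace.
Variables (R : realType) (n : nat) (a b : R) (x beta : nat -> R).
Hypotheses (hn : (1 <= n)%N) (hx : is_partition a b n x).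
Hypothesis (hbeta : forall i : nat, (1 <= i <= n)%N -> -1 <= beta i /\ beta i < 0).
Implicit Types (d e : nat -> R) (i k m : nat) (f g : R -> R) (t : R).

Let x0 : x 0%N = a. Proof. by case: hx. Qed.
Let xn : x n = b. Proof. by case: hx => _ []. Qed.

Lemma knot_ltS i : (1 <= i <= n)%N -> x i.-1 < x i.
Proof. by case: hx => _ [_]; exact. Qed.

Lemma knot_le i j : (i <= j <= n)%N -> x i <= x j.
Proof.
elim: j => [|j IH] /andP[ij jn]; first by move: ij; rewrite leqn0 => /eqP ->.
move: ij; rewrite leq_eqVlt => /predU1P[->//|]; rewrite ltnS => ij.
apply: le_trans (IH _) _; first by rewrite ij ltnW.
by apply: ltW; exact: (@knot_ltS j.+1).
Qed.

Lemma knot_lt i j : (i < j <= n)%N -> x i < x j.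
Proof.
move=> /andP[ij jn]; apply: lt_le_trans (@knot_ltS i.+1 _) _; first lia.
by apply: knot_le; rewrite ij.
Qed.

Let cover t : t \in `[a, b] -> exists i, (1 <= i <= n)%N /\ t \in `[x i.-1, x i].
Proof. by rewrite -x0 -xn; exact: knot_itv_cover hn. Qed.

Lemma knot_itv_sub i t : (1 <= i <= n)%N -> t \in `[x i.-1, x i] -> t \in `[a, b].
Proof.
move=> /andP[i1 iln]; rewrite !in_itv/= => /andP[it ti].
rewrite -x0 -xn (le_trans _ it) ?(le_trans ti) //; apply: knot_le; lia.
Qed.

(** The weights from which [omega] is built: width i times a derivative at a
    knot is a difference of consecutive B-coefficients. *)
Let width i := theta_of (beta i) * (x i - x i.-1).

Lemma width_gt0 i : (1 <= i <= n)%N -> 0 < width i.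
Proof.
move=> iN; apply: mulr_gt0; last by rewrite subr_gt0 knot_ltS.
by have /andP[] := theta_itv (hbeta iN).
Qed.

Lemma omega_itv i : (1 <= i < n)%N -> 0 <= omega x beta i <= 1.
Proof.
move=> iN; have w0 : 0 < width i by apply: width_gt0; lia.
have w1 : 0 < width i.+1 by apply: width_gt0; lia.
rewrite /omega -/(width i) -/(width i.+1) ler_pdivlMr ?ler_pdivrMr ?addr_gt0 //.
by rewrite mul0r mul1r ltW//= lerDr ltW.
Qed.

Lemma knot_value_ge0 d i : (i <= n)%N -> (forall k, 0 <= d k) ->
  0 <= knot_value n x beta d i.
Proof.
move=> iN d0; rewrite /knot_value; have [_|i0] := eqVneq i 0%N; first exact: d0.
have [_|iNn] := eqVneq i n; first exact: d0.
have iN' : (1 <= i < n)%N by lia.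
have /andP[w0 w1] := omega_itv iN'.
by apply: addr_ge0; apply: mulr_ge0; rewrite ?subr_ge0.
Qed.

(** Continuity of g at the knots is built in, because both adjacent lists contain
    the value at the common knot; continuity of g' is a consequence, see
    [has_spline_bcoefs_GS2]. *)
Definition has_spline_bcoefs d g := fun_on a b g /\
  forall i, (1 <= i <= n)%N -> merrien_space (beta i) (x i.-1) (x i) g /\
    bcoefs (beta i) (x i.-1) (x i) g = spline_bcoefs n x beta d i.

(** The pieces given by [merrien_exists] are concatenated from left to right;
    consecutive lists share the value at their common knot, so each piece keeps
    its B-coefficients. *)
Lemma has_spline_bcoefs_exists d : exists g, has_spline_bcoefs d g.
Proof.
suff [g gE] : exists g, forall i, (1 <= i <= n)%N ->
    merrien_space (beta i) (x i.-1) (x i) g /\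
    bcoefs (beta i) (x i.-1) (x i) g = spline_bcoefs n x beta d i.
  exists (fun t => if t \in `[a, b] then g t else 0); split.
    by move=> t /negbTE ->.
  move=> i iN; have [gV <-] := gE i iN.
  apply: merrien_eq gV; first exact: knot_ltS.
  by move=> t /(knot_itv_sub iN) ->.
suff : forall m, (m <= n)%N -> exists g, (forall i, (1 <= i <= m)%N ->
    merrien_space (beta i) (x i.-1) (x i) g /\
    bcoefs (beta i) (x i.-1) (x i) g = spline_bcoefs n x beta d i) /\
    g (x m) = knot_value n x beta d m.
  by move=> /(_ n (leqnn n)) [g [gE _]]; exists g.
elim=> [_|m IH mn].
  by exists (cst (knot_value n x beta d 0)); split => // i /andP[/leq_trans H /H].
have [g [gE gm]] := IH (ltnW mn).
have mN : (1 <= m.+1 <= n)%N by [].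
have xm := knot_ltS mN; rewrite succnK in xm.
have [f [fV fE]] := merrien_exists (hbeta mN) (knot_value n x beta d m)
  (d (2 * m + 1)%N) (d (2 * m.+1)%N) (knot_value n x beta d m.+1) xm.
have [f0 _ _ f1] := fE.
exists (fun t => if t <= x m then g t else f t); split; last by rewrite leNgt xm.
move=> i /andP[i1]; rewrite leq_eqVlt => /predU1P[->|im].
  rewrite succnK -[spline_bcoefs _ _ _ _ _]fE; apply: merrien_eq fV => //.
  move=> t; rewrite in_itv/= => /andP[mt _].
  case: (leP t (x m)) => // tm.
  have -> : t = x m by apply/eqP; rewrite eq_le tm.
  by rewrite f0 gm.
have [gV <-] := gE i (introT andP (conj i1 im)).
apply: merrien_eq gV; first by apply: knot_ltS; lia.
move=> t; rewrite in_itv/= => /andP[_ ti].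
by rewrite (le_trans ti) //; apply: knot_le; lia.
Qed.

Lemma has_spline_bcoefs_unique d f g :
  has_spline_bcoefs d f -> has_spline_bcoefs d g -> f = g.
Proof.
move=> [f0 fE] [g0 gE]; apply/funext => t.
have [tab|tab] := boolP (t \in `[a, b]); last by rewrite f0 // g0.
move: tab => /cover[i [iN ti]].
have [fV fc] := fE i iN; have [gV gc] := gE i iN.
by apply: (merrien_unique (hbeta iN) (knot_ltS iN) fV gV _ ti); rewrite fc gc.
Qed.

Lemma has_spline_bcoefs_lin d e f g (c : R) :
  has_spline_bcoefs d f -> has_spline_bcoefs e g ->
  has_spline_bcoefs (fun k => c * d k + e k) (c *: f + g).
Proof.
move=> [f0 fE] [g0 gE]; split.
  by move=> t tab; rewrite !fctE f0 // g0 // scaler0 addr0.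
move=> i iN; have [fV fc] := fE i iN; have [gV gc] := gE i iN.
have xi := knot_ltS iN.
split; first by apply: merrien_lin => //; exact: hbeta.
apply: (@eq_from_nth _ 0) => // j _.
by rewrite bcoefs_lin // fc gc spline_bcoefs_lin.
Qed.

Lemma has_spline_bcoefs0 : has_spline_bcoefs (fun=> 0) 0.
Proof.
split => // i iN; have [V ->] := merrien_cst (beta i) 0 (knot_ltS iN).
by split => //; rewrite /spline_bcoefs /knot_value !mulr0 addr0; do !case: ifP.
Qed.

Lemma has_spline_bcoefs_sum m (c : 'I_m -> R) (d : 'I_m -> nat -> R)
    (f : 'I_m -> R -> R) : (forall k : 'I_m, has_spline_bcoefs (d k) (f k)) ->
  has_spline_bcoefs (fun j => \sum_(k < m) c k * d k j) (\sum_(k < m) c k *: f k).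
Proof.
elim: m c d f => [|m IH] c d f H.
  rewrite big_ord0 (_ : (fun _ => _) = fun=> 0); first exact: has_spline_bcoefs0.
  by apply/funext => j; rewrite big_ord0.
rewrite big_ord_recl (_ : (fun _ => _) = fun j => c ord0 * d ord0 j +
    \sum_(k < m) c (lift ord0 k) * d (lift ord0 k) j).
  apply: has_spline_bcoefs_lin => //.
  exact: (IH (c \o lift ord0) (d \o lift ord0) (f \o lift ord0)
    (fun k : 'I_m => H (lift ord0 k))).
by apply/funext => j; rewrite big_ord_recl.
Qed.

(** Here G is the value at the knot, D and D' the left and right derivatives, y
    and z the B-coefficients next to G. The right-hand combination equals G plus
    a positive multiple of D' - D. *)
Lemma derive_match i (D D' G y z : R) : (1 <= i < n)%N ->
  y = G - width i * D -> z = G + width i.+1 * D' ->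
  (D = D') <-> (G = omega x beta i * y + (1 - omega x beta i) * z).
Proof.
move=> iN -> ->; have w0 : 0 < width i by apply: width_gt0; lia.
have w1 : 0 < width i.+1 by apply: width_gt0; lia.
have w2 : width i + width i.+1 != 0 by rewrite gt_eqF // addr_gt0.
rewrite /omega -/(width i) -/(width i.+1).
have E : width i.+1 / (width i + width i.+1) * (G - width i * D) +
   (1 - width i.+1 / (width i + width i.+1)) * (G + width i.+1 * D') =
   G + width i * width i.+1 / (width i + width i.+1) * (D' - D) by field.
rewrite E; split=> [->|]; first by rewrite subrr mulr0 addr0.
move=> H; apply/eqP; rewrite eq_sym -subr_eq0.
have : width i * width i.+1 / (width i + width i.+1) * (D' - D) == 0.
  by apply/eqP; apply: (addrI G); rewrite -H addr0.
move: w0 w1 w2; move: (width i) (width i.+1) => u v u0 v0 w2.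
by rewrite !mulf_eq0 invr_eq0 (negbTE w2) (gt_eqF u0) (gt_eqF v0).
Qed.

(** Gluing from left to right: by [derive_match] the choice of the knot values
    is what makes the one-sided derivatives agree. *)
Lemma has_spline_bcoefs_GS2 d g : has_spline_bcoefs d g -> GS2 a b n x beta g.
Proof.
move=> [g0 gE]; split => //; split; last by move=> i /gE[].
suff : forall m, (m < n)%N -> C1_on `[x 0%N, x m.+1] g /\
    derive_on `[x 0%N, x m.+1] g (x m.+1) = derive_on `[x m, x m.+1] g (x m.+1).
  move=> H; have nE : n = n.-1.+1 by lia.
  by rewrite -x0 -xn nE; apply: (H n.-1 _).1; lia.
elim=> [|m IH] mn; first by have [[]] := gE 1%N mn.
have [gC dgC] := IH (ltnW mn).
have mN : (1 <= m.+2 <= n)%N by lia.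
have mN' : (1 <= m.+1 <= n)%N by lia.
have [[gC' _] gc'] := gE _ mN; have [_ gc] := gE _ mN'.
rewrite !succnK in gC' gc' gc.
have xm : x 0%N < x m.+1 by apply: knot_lt; lia.
have xm' : x m.+1 < x m.+2 := knot_ltS mN.
have C : C1_on `[x 0%N, x m.+2] g.
  apply: C1_on_glue gC gC' _ => //; rewrite dgC.
  have iN : (1 <= m.+1 < n)%N by lia.
  case: gc => _ _ e2 e3; case: gc' => _ e1' _ _.
  apply/(derive_match iN (esym e2) (esym e1')).
  rewrite e3 /knot_value /=; case: eqP => [|_]; first lia.
  by congr (_ * d _ + _ * d _); lia.
split => //; apply: esym; apply: (derive_on_sub _ _ C) => //.
  by move=> t /=; rewrite !in_itv/= => /andP[? ->]; rewrite (le_trans (ltW xm)).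
by rewrite in_itv/= lexx ltW.
Qed.

(** The even and odd coordinates are the B-coefficients on either side of a knot;
    that the knot values are then the prescribed combinations is the continuity
    of g' there. *)
Lemma GS2_has_spline_bcoefs g : GS2 a b n x beta g -> exists d, has_spline_bcoefs d g.
Proof.
move=> [g0 [gC gV]].
pose D := derive_on `[a, b] g.
pose d k := if k == 0%N then g a else if k == (2 * n + 1)%N then g b
  else if odd k then g (x k./2) + width k./2.+1 * D (x k./2)
  else g (x k./2) - width k./2 * D (x k./2).
have dE i t : (1 <= i <= n)%N -> t \in `[x i.-1, x i] ->
    derive_on `[x i.-1, x i] g t = D t.
  move=> iN; apply: (derive_on_sub _ _ gC); first exact: knot_ltS.
  by move=> s; exact: knot_itv_sub.
have d_even i : (1 <= i <= n)%N -> d (2 * i)%N = g (x i) - width i * D (x i).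
  move=> iN; rewrite /d mul2n odd_double doubleK.
  by do 2!(case: eqP => [|_]; first lia).
have d_odd i : (i < n)%N -> d (2 * i + 1)%N = g (x i) + width i.+1 * D (x i).
  move=> iN; rewrite /d addn1 mul2n /= odd_double /= uphalf_double.
  by case: eqP => [|_]; first lia.
have knotE i : (i <= n)%N -> knot_value n x beta d i = g (x i).
  move=> iN; rewrite /knot_value; have [->|i0] := eqVneq i 0%N; first by rewrite x0.
  have [->|iNn] := eqVneq i n; first by rewrite xn /d eqxx; case: eqP => [|_] //; lia.
  have iN' : (1 <= i < n)%N by lia.
  apply: esym; apply/(derive_match iN' (d_even i _) (d_odd i _)) => //; lia.
exists d; split => // i iN; split; first exact: gV.
rewrite /bcoefs /spline_bcoefs !knotE ?d_even ?d_odd; [|lia..].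
have xi := ltW (knot_ltS iN); have iE : i.-1.+1 = i by lia.
by rewrite !dE // ?iE ?in_itv/= ?lexx ?xi.
Qed.

Lemma bsplineP k : (k < 2 * n + 2)%N ->
  has_spline_bcoefs (fun j => (j == k)%:R) (bspline a b n x beta k).
Proof.
move=> kn; have [g gE] := has_spline_bcoefs_exists (fun j => (j == k)%:R).
have : is_bspline a b n x beta k (bspline a b n x beta k).
  rewrite /bspline; apply: (xgetPex _ (P := is_bspline a b n x beta k)).
  exists g; split; first exact: gE.1.
  by move=> i iN; rewrite bspline_bcoefsE //; exact: gE.2.
move=> [B0 BE]; split => // i iN.
by rewrite -bspline_bcoefsE //; exact: BE.
Qed.

Lemma has_spline_bcoefs_ext d e g : (forall k, (k < 2 * n + 2)%N -> d k = e k) ->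
  has_spline_bcoefs d g -> has_spline_bcoefs e g.
Proof.
move=> de [g0 gE]; split => // i iN; have [gV gc] := gE i iN.
by split => //; rewrite gc; exact: eq_spline_bcoefs.
Qed.

Lemma has_spline_bcoefs_comb d : has_spline_bcoefs d
  (\sum_(k < 2 * n + 2) d k *: bspline a b n x beta k).
Proof.
have H := has_spline_bcoefs_sum (fun k : 'I_(2 * n + 2) => d k)
  (fun k : 'I_(2 * n + 2) => bsplineP (ltn_ord k)).
apply: has_spline_bcoefs_ext H => k kn.
rewrite (bigD1 (Ordinal kn)) //= eqxx mulr1 big1 ?addr0 // => i ik.
by rewrite (_ : (k == i) = false) ?mulr0 //; apply/negbTE; rewrite eq_sym.
Qed.

Lemma bsplines_free (c : 'I_(2 * n + 2) -> R) :
  \sum_(k < 2 * n + 2) c k *: bspline a b n x beta k = 0 ->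
  forall k : 'I_(2 * n + 2), c k = 0.
Proof.
have [d cd] := extend_ord c; under eq_bigr do rewrite cd.
move=> s0 k; rewrite cd.
have [_ dE] := has_spline_bcoefs_comb d; have [_ zE] := has_spline_bcoefs0.
rewrite s0 in dE.
apply: (spline_bcoefs_inj (e := fun=> 0) (x := x) (beta := beta) hn) => // i iN.
by rewrite -(dE i iN).2 (zE i iN).2.
Qed.

Lemma GS2_spanned g : GS2 a b n x beta g <->
  exists c : 'I_(2 * n + 2) -> R, g = \sum_(k < 2 * n + 2) c k *: bspline a b n x beta k.
Proof.
split=> [/GS2_has_spline_bcoefs[d dg]|[c ->]].
  exists (fun k : 'I_(2 * n + 2) => d k).
  exact: has_spline_bcoefs_unique dg (has_spline_bcoefs_comb d).
have [d cd] := extend_ord c; under eq_bigr do rewrite cd.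
exact: has_spline_bcoefs_GS2 (has_spline_bcoefs_comb d).
Qed.

Lemma bspline_ge0 k t : (k < 2 * n + 2)%N -> t \in `[a, b] ->
  0 <= bspline a b n x beta k t.
Proof.
move=> kn /cover[i [iN ti]].
have [_ /(_ i iN)[BV Bc]] := bsplineP kn.
apply: (merrien_ge0 (hbeta iN) (knot_ltS iN) BV _ ti) => j; rewrite Bc.
have K m : (m <= n)%N -> 0 <= knot_value n x beta (fun j => (j == k)%:R) m.
  by move=> mn; apply: knot_value_ge0 => // l; exact: ler0n.
by case: j => [|[|[|[|j]]]] /=; rewrite ?nth_nil ?ler0n // K //; lia.
Qed.

Lemma bspline_sum1 t : t \in `[a, b] ->
  \sum_(k < 2 * n + 2) bspline a b n x beta k t = 1.
Proof.
move=> /cover[i [iN ti]].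
have [_ /(_ i iN)[sV sc]] := has_spline_bcoefs_comb (fun=> 1).
have [oneV onec] := merrien_cst (beta i) 1 (knot_ltS iN).
have <- : (\sum_(k < 2 * n + 2) 1 *: bspline a b n x beta k) t = 1.
  have := merrien_unique (hbeta iN) (knot_ltS iN) sV oneV.
  apply => //; rewrite sc onec /spline_bcoefs /knot_value.
  by congr [:: _; _; _; _]; case: ifP => // _; case: ifP => // _;
    rewrite !mulr1 addrC subrK.
by rewrite fct_sumE; apply: eq_bigr => k _; rewrite scale1r.
Qed.

End SplineSpace.

Theorem theorem1 (R : realType) (n : nat) (a b : R) (x beta : nat -> R)
    (hn : (1 <= n)%N)
    (hx : is_partition a b n x)
    (hbeta : forall i : nat, (1 <= i <= n)%N -> -1 <= beta i /\ beta i < 0) :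
  is_basis (GS2 a b n x beta)
    (fun k : 'I_(2 * n + 2) => bspline a b n x beta k) /\
  (forall (k : 'I_(2 * n + 2)) (t : R),
    t \in `[a, b] -> 0 <= bspline a b n x beta k t) /\
  (forall t : R, t \in `[a, b] ->
    \sum_(k < 2 * n + 2) bspline a b n x beta k t = 1).
Proof.
split; first by split; [exact: bsplines_free hn hx hbeta|exact: GS2_spanned hn hx hbeta].
split=> [k t|t]; last exact: bspline_sum1.
exact: bspline_ge0 hn hx hbeta _ _ (ltn_ord k).
Qed.
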